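(* Let $k$ be an infinite field, $n\ge2$, and $<$ a product order on $k[X_1,\ldots,X_n]$ with $X_1<\cdots<X_n$. Let $A\subseteq k^n$ be a finite union of pairwise distinct affine $d$-planes such that for every irreducible component of $A$, $X_1$ is one of its minimal free variables. For $\lambda\in k$ let $A_\lambda=\{a'\in k^{n-1};\ (\lambda,a')\in A\}$, and let $\delta\subseteq\mathbb{N}^{n-1}$ be the generic standard set, i.e. the common value of $D(A_\lambda)$ (w.r.t. the restriction of $<$ to $k[X_2,\ldots,X_n]$) for all $\lambda$ in some nonempty Zariski-open $U\subseteq k$. Then $\mathbb{N}e_1\oplus\delta:=\{\alpha\in\mathbb{N}^n;\ p(\alpha)\in\delta\}$ is contained in $D(A)$, and it is the largest subset of $D(A)$ that is a union of $1$-planes parallel to $\mathbb{N}e_1$; that is, for $\beta\in\mathbb{N}^{n-1}$, $\{(t,\beta);\ t\in\mathbb{N}\}\subseteq D(A)$ holds if and only if $\beta\in\delta$.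
   Context: $p:\mathbb{N}^n\to\mathbb{N}^{n-1}$ deletes the first coordinate. A term order $<$ on $k[X_1,\ldots,X_n]$ is a product order if $\alpha<\beta$ iff either $p(\alpha)<p(\beta)$, or $p(\alpha)=p(\beta)$ and $\alpha_1<\beta_1$. For $B\subseteq k^m$, $I(B)$ is the vanishing ideal, ${\rm LE}(f)$ the leading exponent, $C(B)=\{{\rm LE}(f);\ 0\ne f\in I(B)\}$, $D(B)=\mathbb{N}^m\setminus C(B)$. A $1$-plane parallel to $\mathbb{N}e_1$ is a set $\gamma+\mathbb{N}e_1$ with $\gamma\in\mathbb{N}^n$, $\gamma_1=0$. An affine $d$-plane is a translate of a $d$-dimensional linear subspace; for $\#J=d$, $\{X_j;\ j\in J\}$ is a set of free variables of an affine $d$-plane $A'$ if the projection $A'\to k^J$ is bijective, and minimal if moreover no exchange of some $j\in J$ by some $i\notin J$ with $i<j$ yields a set of free variables. *)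

(* Defs.v *)
From HB Require Import structures.
From mathcomp Require Import all_boot all_order all_algebra.
Set Implicit Arguments. Unset Strict Implicit. Unset Printing Implicit Defensive.
Import Order.TTheory GRing.Theory Num.Theory.
Local Open Scope ring_scope.

(* Polynomials in k[X_1..X_n] are represented as finite formal sums          *)
(* (lists of (coefficient, exponent) pairs); the coefficient of X^alpha is    *)
(* the sum of the coefficients listed with exponent alpha.                    *)
Definition mpoly (k : fieldType) (n : nat) := seq (k * n.-tuple nat).

Definition mcoef (k : fieldType) n (f : mpoly k n) (a : n.-tuple nat) : k :=
  \sum_(m <- f | m.2 == a) m.1.

Definition meval (k : fieldType) n (f : mpoly k n) (x : 'rV[k]_n) : k :=
  \sum_(m <- f) m.1 * \prod_(i < n) x 0 i ^+ tnth m.2 i.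

Definition exp0 n : n.-tuple nat := [tuple 0%N | i < n].
Definition expe n (i : 'I_n) : n.-tuple nat := [tuple (i == j : nat) | j < n].
Definition expadd n (a b : n.-tuple nat) : n.-tuple nat :=
  [tuple (tnth a i + tnth b i)%N | i < n].

Definition term_order n (lt : rel (n.-tuple nat)) : Prop :=
  [/\ irreflexive lt, transitive lt,
      (forall a b, a <> b -> lt a b \/ lt b a),
      (forall a b c, lt a b -> lt (expadd a c) (expadd b c)) &
      (forall a, a <> exp0 n -> lt (exp0 n) a)].

Definition pdel m (a : m.+1.-tuple nat) : m.-tuple nat := [tuple of behead a].
Definition econs m (t : nat) (b : m.-tuple nat) : m.+1.-tuple nat :=
  [tuple of t :: b].

Definition restr_order m (lt : rel (m.+1.-tuple nat)) : rel (m.-tuple nat) :=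
  fun b c => lt (econs 0 b) (econs 0 c).

Definition product_order m (lt : rel (m.+1.-tuple nat)) : Prop :=
  forall a b, lt a b =
    restr_order lt (pdel a) (pdel b) || (pdel a == pdel b) && (thead a < thead b)%N.

Definition is_LE (k : fieldType) n (lt : rel (n.-tuple nat)) (f : mpoly k n)
    (a : n.-tuple nat) : Prop :=
  mcoef f a != 0 /\ (forall b, mcoef f b != 0 -> b = a \/ lt b a).

Definition in_IB (k : fieldType) n (B : 'rV[k]_n -> Prop) (f : mpoly k n) : Prop :=
  forall x, B x -> meval f x = 0.

Definition Cset (k : fieldType) n (lt : rel (n.-tuple nat)) (B : 'rV[k]_n -> Prop)
    (a : n.-tuple nat) : Prop :=
  exists f : mpoly k n, in_IB B f /\ is_LE lt f a.
Definition Dset (k : fieldType) n (lt : rel (n.-tuple nat)) (B : 'rV[k]_n -> Prop)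
    (a : n.-tuple nat) : Prop := ~ Cset lt B a.

Definition plane (k : fieldType) n d (P : 'rV[k]_n * 'M[k]_(d, n)) : 'rV[k]_n -> Prop :=
  fun x => (x - P.1 <= P.2)%MS.
Definition is_dplane (k : fieldType) n d (P : 'rV[k]_n * 'M[k]_(d, n)) : bool :=
  row_free P.2.

Definition free_vars (k : fieldType) n d (A' : 'rV[k]_n -> Prop) (J : {set 'I_n}) : Prop :=
  #|J| = d /\
  forall y : 'rV[k]_n, exists! x, A' x /\ (forall j, j \in J -> x 0 j = y 0 j).

Definition minimal_free_vars (k : fieldType) n d (A' : 'rV[k]_n -> Prop)
    (J : {set 'I_n}) : Prop :=
  free_vars d A' J /\
  forall j i, j \in J -> i \notin J -> (i < j)%N -> ~ free_vars d A' (i |: (J :\ j)).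

Definition pcons (k : fieldType) m (l : k) (a' : 'rV[k]_m) : 'rV[k]_m.+1 :=
  \row_(i < m.+1) match unlift ord0 i with Some j => a' 0 j | None => l end.

Definition fiber (k : fieldType) m (A : 'rV[k]_m.+1 -> Prop) (l : k) : 'rV[k]_m -> Prop :=
  fun a' => A (pcons l a').

(* Main.v *)
Require Import Defs.
From HB Require Import structures.
From mathcomp Require Import all_boot all_order all_algebra.
From mathcomp Require Import mpoly ring.
From Stdlib Require Import Classical.
Import Order.TTheory GRing.Theory Num.Theory.
Set Implicit Arguments. Unset Strict Implicit. Unset Printing Implicit Defensive.
Local Open Scope ring_scope.

(**
Write R = k[X_1][X_2, .., X_n]. For a product order, the leading exponent of
f in R is (t, b) where b leads f over k[X_1] and t is the degree in X_1 of the
coefficient of X'^b. Specializing X_1 at a non-root of that coefficient keeps b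
as leading exponent, so C(A) projects into the generic C(A_l): this gives
N e_1 + delta inside D(A).

Conversely a polynomial f0 in I(A_l) with leading exponent b must be lifted to
I(A) for one generic l.
- Lifting f0 to some f in I(A) with f(l, .) = f0 goes by induction on the planes.
  If f1 in I(A') lifts f0 and P is the next plane, then composing f1 with an
  affine retraction onto P that preserves X_1 (it exists because X_1 is free on P)
  gives a polynomial (X_1 - l) h, which lies in I(A') + I(P). For generic l the
  factor X_1 - l is a nonzerodivisor modulo this ideal, so h lies in it too, and
  its I(A') part corrects f1.
- The leading exponent of f may exceed b, its coefficient vanishing at l. Reducing
  f modulo a Groebner basis of I(A) over k(X_1), whose leading coefficients do not
  vanish at l, lowers it down to b while only rescaling f(l, .).
*)

(** * Dickson's lemma and term orders *)

Definition ctuple m (a b : m.-tuple nat) := forall i, (tnth a i <= tnth b i)%N.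

Lemma tnth_econs0 m t (b : m.-tuple nat) : tnth (econs t b) ord0 = t.
Proof. by rewrite (tnth_nth 0%N). Qed.

Lemma tnth_econsS m t (b : m.-tuple nat) i :
  tnth (econs t b) (lift ord0 i) = tnth b i.
Proof. by rewrite !(tnth_nth 0%N). Qed.

Lemma econs_thead m (a : m.+1.-tuple nat) : econs (thead a) (pdel a) = a.
Proof. by apply: val_inj; case/tupleP: a => t b; rewrite /= theadE. Qed.

Lemma pdel_econs m t (b : m.-tuple nat) : pdel (econs t b) = b.
Proof. exact: val_inj. Qed.

Lemma thead_econs m t (b : m.-tuple nat) : thead (econs t b) = t.
Proof. exact: theadE. Qed.

Lemma ctuple_econs m t u (b c : m.-tuple nat) :
  (t <= u)%N -> ctuple b c -> ctuple (econs t b) (econs u c).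
Proof.
move=> tu bc i; case: (unliftP ord0 i) => [j ->|->].
  by rewrite !tnth_econsS.
by rewrite !tnth_econs0.
Qed.

(** Induction on m. Finitely many tails cover all tails of C, each completed by a head at most T;
    this settles heads at least T. Each of the finitely many slices with head below T is covered by
    induction. *)
Lemma dickson m (C : m.-tuple nat -> Prop) :
  exists s : seq (m.-tuple nat), (forall a, a \in s -> C a) /\
    forall c, C c -> exists2 a, a \in s & ctuple a c.
Proof.
elim: m C => [|m IH] C.
  case: (classic (C [tuple])) => hC.
    exists [:: [tuple]]; split=> [a|c _]; first by rewrite (tuple0 a).
    by exists [tuple] => [|[]]; rewrite ?inE.
  by exists [::]; split=> // c; rewrite (tuple0 c).
have [s' [s'C s'le]] := IH (fun b => exists t, C (econs t b)).
have [s1 [T [s1C s1le]]] : exists (s1 : seq (m.+1.-tuple nat)) (T : nat), (forall a, a \in s1 -> C a) /\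
    (forall b, b \in s' -> exists t, econs t b \in s1 /\ (t <= T)%N).
  elim: s' s'C {s'le} => [|b s' IHs] s'C; first by exists [::], 0%N.
  have [|s1 [T [s1C s1le]]] := IHs.
    by move=> a ain; apply: s'C; rewrite inE ain orbT.
  have [t Ct] := s'C b (mem_head _ _).
  exists (econs t b :: s1), (maxn t T); split=> [a|b'].
    by rewrite inE => /predU1P[->|/s1C].
  rewrite inE => /predU1P[->|/s1le [u [uin uT]]].
    by exists t; rewrite inE eqxx leq_maxl.
  by exists u; rewrite inE uin orbT leq_max uT orbT.
have [s2 [s2C s2le]] : exists s2 : seq (m.+1.-tuple nat), (forall a, a \in s2 -> C a) /\
    (forall t b, (t < T)%N -> C (econs t b) ->
       exists2 a, a \in s2 & ctuple a (econs t b)).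
  elim: T {s1le} => [|T [s2 [s2C s2le]]]; first by exists [::].
  have [s3 [s3C s3le]] := IH (fun b => C (econs T b)).
  exists (s2 ++ [seq econs T b | b <- s3]); split=> [a|t b].
    by rewrite mem_cat => /orP[/s2C //|/mapP[b /s3C Cb ->]].
  rewrite ltnS leq_eqVlt => /predU1P[->|tT] Ctb.
    have [a ain ab] := s3le b Ctb.
    exists (econs T a); first by rewrite mem_cat map_f ?orbT.
    exact: ctuple_econs.
  by have [a ain ab] := s2le t b tT Ctb; exists a; rewrite // mem_cat ain.
exists (s1 ++ s2); split=> [a|c Cc].
  by rewrite mem_cat => /orP[/s1C|/s2C].
rewrite -(econs_thead c) in Cc *; move: (thead c) (pdel c) Cc => t b Cc {c}.
case: (ltnP t T) => tT.
  by have [a ain ac] := s2le t b tT Cc; exists a; rewrite // mem_cat ain orbT.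
have [b' b'in b'b] := s'le b (ex_intro _ t Cc).
have [u [uin uT]] := s1le b' b'in.
exists (econs u b'); first by rewrite mem_cat uin.
exact: ctuple_econs (leq_trans uT tT) b'b.
Qed.

Lemma total_seq_max (T : eqType) (lt : rel T) (s : seq T) :
    transitive lt -> (forall a b, a <> b -> lt a b \/ lt b a) -> s != [::] ->
  exists2 a, a \in s & forall b, b \in s -> b = a \/ lt b a.
Proof.
move=> tr tot; elim: s => // x [|y s] IH _.
  by exists x => [|b]; rewrite !inE // => /eqP; left.
have [a ain amax] := IH isT.
case: (classic (x = a \/ lt x a)) => [h|/not_or_and[xa nxa]].
  by exists a => [|b]; rewrite inE ?ain ?orbT // => /predU1P[->|/amax].
have ax : lt a x by case: (tot _ _ xa).
exists x => [|b]; rewrite inE ?eqxx // => /predU1P[->|/amax [->|ba]].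
- by left.
- by right.
- by right; apply: tr ba ax.
Qed.

Section TermOrder.
Variables (m : nat) (lt : rel (m.-tuple nat)).
Hypothesis lt_term : term_order lt.

Lemma term_order_ctuple (a b : m.-tuple nat) : ctuple a b -> b = a \/ lt a b.
Proof.
case: lt_term => _ _ _ ltD lt0 ab.
pose d : m.-tuple nat := [tuple (tnth b i - tnth a i)%N | i < m].
have eb : b = expadd d a.
  by apply: eq_from_tnth => i; rewrite !tnth_mktuple subnK.
have ea : a = expadd (exp0 m) a.
  by apply: eq_from_tnth => i; rewrite !tnth_mktuple.
have [d0|/eqP d0] := eqVneq d (exp0 m); first by left; rewrite eb d0 -ea.
by right; rewrite eb [X in lt X]ea; apply/ltD/lt0.
Qed.

(** Well-foundedness from Dickson: finitely many counterexamples lie below all others for [ctuple],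
    hence for the term order, so the smallest of them is a least counterexample. *)
Lemma term_order_ind (P : m.-tuple nat -> Prop) :
  (forall a, (forall b, lt b a -> P b) -> P a) -> forall a, P a.
Proof.
move=> IH a; apply: NNPP => nPa.
have [s [sC sle]] := dickson (fun b => ~ P b).
have [_ tr tot _ _] := lt_term.
have [a0 a0in _] := sle a nPa.
have [||| b bin bmin] := @total_seq_max _ (fun x y => lt y x) s.
- by move=> y x z xy yz; apply: tr yz xy.
- by move=> x y /tot[]; [right|left].
- by case: (s) a0in.
apply: (sC b bin); apply: IH => c cb; apply: NNPP => nPc.
have [a1 a1in /term_order_ctuple a1c] := sle c nPc.
have [irr _ _ _ _] := lt_term.
have bc : c = b \/ lt b c.
  case: (bmin _ a1in) a1c => [->|ba1] [->|a1c]; auto; right; exact: tr a1c.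
case: bc cb => [->|bc cb]; first by rewrite irr.
by have := tr _ _ _ bc cb; rewrite irr.
Qed.

Section Lead.
Variable R : idomainType.
Implicit Types F G : {mpoly R[m]}.

Definition is_lead F (b : 'X_{1..m}) :=
  F@_b != 0 /\ forall c, F@_c != 0 -> c = b \/ lt c b.

Lemma lead_exists F : F != 0 -> exists b, is_lead F b.
Proof.
rewrite -msupp_eq0 => F0.
have [_ tr tot _ _] := lt_term.
have [||b bin bmax] := @total_seq_max _ (fun x y : 'X_{1..m} => lt x y) (msupp F) _ _ F0.
- by move=> y x z; apply: tr.
- by move=> x y xy; apply: tot => /val_inj.
by exists b; split=> [|c]; rewrite -mcoeff_msupp //; apply: bmax.
Qed.

(** The coefficients lie in a domain, so F is multiplied by the leading coefficient of G rather than
    divided by it; the terms at b cancel. *)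
Lemma lead_reduce F G b c : is_lead F b -> is_lead G c -> (c <= b)%MM ->
  forall e, (G@_c *: F - F@_b *: ('X_[b - c] * G))@_e != 0 -> lt e b.
Proof.
move=> [Fb Fmax] [Gc Gmax] cb e.
have [_ tr tot ltD _] := lt_term.
have [->|eb] := eqVneq e b.
  have := mcoeffMX G (b - c) c; rewrite submK // mulrC => GX.
  by rewrite mcoeffB !mcoeffZ GX mulrC subrr eqxx.
have [Fe|/Fmax[/eqP|//]] := eqVneq F@_e 0; last by rewrite (negbTE eb).
rewrite mcoeffB !mcoeffZ Fe mulr0 sub0r oppr_eq0 mulf_eq0 negb_or => /andP[_].
rewrite -mcoeff_msupp mulrC (perm_mem (msuppMX _ _)).
case/mapP=> d; rewrite mcoeff_msupp => /Gmax[->|dc] ee.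
  by rewrite ee submK // eqxx in eb.
have := ltD _ _ (b - c)%MM dc.
congr lt; apply: eq_from_tnth => i; rewrite tnth_mktuple -!mnm_tnth ?ee.
  by rewrite mnmDE addnC.
by rewrite -[in RHS](submK cb) mnmDE addnC.
Qed.

End Lead.
End TermOrder.

(** * Generic parameters *)

Definition generic (k : fieldType) (Q : k -> Prop) :=
  exists2 c : {poly k}, c != 0 & forall l, c.[l] != 0 -> Q l.

Section Generic.
Variable k : fieldType.

Lemma generic_nonroot (c : {poly k}) : c != 0 -> generic (fun l => c.[l] != 0).
Proof. by exists c. Qed.

Lemma generic_and (P Q : k -> Prop) :
  generic P -> generic Q -> generic (fun l => P l /\ Q l).
Proof.
move=> [c c0 cP] [d d0 dQ]; exists (c * d) => [|l]; first by rewrite mulf_neq0.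
by rewrite hornerM mulf_eq0 negb_or => /andP[/cP ? /dQ ?].
Qed.

Lemma generic_imp (P Q : k -> Prop) :
  (forall l, P l -> Q l) -> generic P -> generic Q.
Proof. by move=> PQ [c c0 cP]; exists c => // l /cP/PQ. Qed.

Lemma generic_all (T : eqType) (s : seq T) (P : T -> k -> Prop) :
  (forall a, a \in s -> generic (P a)) -> generic (fun l => forall a, a \in s -> P a l).
Proof.
elim: s => [|a s IH] sP; first by exists 1; rewrite ?oner_eq0.
have [||c c0 cP] := @generic_and (P a) (fun l => forall a, a \in s -> P a l).
- exact/sP/mem_head.
- by apply: IH => b bs; apply: sP; rewrite inE bs orbT.
by exists c => // l /cP[Pa Ps] b; rewrite inE => /predU1P[->|/Ps].
Qed.

Lemma generic_notin (s : seq k) : generic (fun l => l \notin s).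
Proof.
exists (\prod_(a <- s) ('X - a%:P)) => [|l].
  by rewrite prodf_seq_neq0; apply/allP => a _; rewrite polyXsubC_eq0.
by rewrite -[_ != 0]/(~~ root _ _) root_prod_XsubC.
Qed.

Hypothesis k_inf : forall s : seq k, exists x : k, x \notin s.

Lemma infinite_nonroot (p : {poly k}) : p != 0 -> exists l, p.[l] != 0.
Proof.
move=> p0; apply: NNPP => np.
have pz l : root p l.
  by apply/rootP/eqP/negPn/negP => pl; apply: np; exists l.
have [s [us ss]] : exists s : seq k, uniq s /\ size s = size p.
  elim: (size p) => [|n [s [us ss]]]; first by exists [::].
  by have [x xs] := k_inf s; exists (x :: s); rewrite /= xs us ss.
have ps : all (root p) s by apply/allP => l _; apply: pz.
by have := max_poly_roots p0 ps us; rewrite ss ltnn.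
Qed.

Lemma generic_exists (Q : k -> Prop) : generic Q -> exists l, Q l.
Proof. by case=> c /infinite_nonroot[l cl] cQ; exists l; apply: cQ. Qed.

End Generic.

(** * Division with denominators prime to X_1 - l *)

Section GenericDivision.
Variables (k : fieldType) (m : nat) (lt : rel (m.-tuple nat)).
Hypothesis lt_term : term_order lt.
Local Notation R := {mpoly {poly k}[m]}.

Definition is_ideal (L : R -> Prop) :=
  [/\ L 0, forall f g, L f -> L g -> L (f + g) & forall f g, L g -> L (f * g)].

Lemma idealZ L c f : is_ideal L -> L f -> L (c *: f).
Proof. by case=> _ _ LM; rewrite -mul_mpolyC; apply: LM. Qed.

Lemma idealB L f g : is_ideal L -> L f -> L g -> L (f - g).
Proof.
move=> Lid; have [_ LD _] := Lid => Lf Lg; apply: LD => //.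
by rewrite -scaleN1r; apply: idealZ.
Qed.

(** Dickson applied to the set of leading exponents, with one polynomial chosen for each basis
    element. Leading coefficients stay uncontrolled, hence the rescaling in later reductions. *)
Lemma lead_cover (L : R -> Prop) : exists G : seq (R * 'X_{1..m}),
  (forall p, p \in G -> L p.1 /\ is_lead lt p.1 p.2) /\
  forall f b, L f -> is_lead lt f b -> exists2 p, p \in G & (p.2 <= b)%MM.
Proof.
have [s [sC sle]] := dickson (fun a => exists2 f, L f & is_lead lt f (Multinom a)).
have [G [GL Gs]] : exists G : seq (R * 'X_{1..m}),
    (forall p, p \in G -> L p.1 /\ is_lead lt p.1 p.2) /\
    forall a, a \in s -> exists2 p, p \in G & p.2 = Multinom a.
  elim: s sC {sle} => [|a s IH] sC; first by exists [::].
  have [|G [GL Gs]] := IH.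
    by move=> b bs; apply: sC; rewrite inE bs orbT.
  have [f Lf fa] := sC a (mem_head _ _).
  exists ((f, Multinom a) :: G); split=> [p|b]; rewrite inE => /predU1P[->|] //.
  - exact: GL.
  - by exists (f, Multinom a); rewrite ?mem_head.
  - by move=> /Gs[p pG pb]; exists p; rewrite // inE pG orbT.
exists G; split=> // f [b] Lf fb.
have [a /Gs[p pG pa] ab] := sle b (ex_intro2 _ _ f Lf fb).
by exists p; rewrite // pa; apply/mnm_lepP => i; apply: ab.
Qed.

(* X - l is a nonzerodivisor modulo L for generic l: elements of the
   k[X]-saturation S of L reduce to 0 modulo a Groebner basis of S using only
   denominators c with c(l) != 0; Bezout between c and X - l then clears c. *)
Lemma saturation_generic (L : R -> Prop) : is_ideal L ->
  generic (fun l => forall h, L (('X - l%:P) *: h) -> L h).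
Proof.
move=> Lid; have [L0 LD LM] := Lid.
(* S consists of the elements that enter L after extending scalars to $k(X_1)$. *)
pose S (h : R) := exists2 c : {poly k}, c != 0 & L (c *: h).
have [G [GS Gcov]] := lead_cover S.
have : generic (fun l => forall p, p \in G ->
    (p.1@_(p.2)).[l] != 0 /\ exists2 c, c.[l] != 0 & L (c *: p.1)).
  apply: generic_all => p /GS[[c c0 Lc] [p0 _]].
  apply: generic_imp (generic_and (generic_nonroot p0) (generic_nonroot c0)).
  by move=> l [pl cl]; split=> //; exists c.
apply: generic_imp => l Gl.
(* Descent on the leading exponent; a is b seen as a tuple, the form that [term_order_ind]
   expects. *)
have denom a (h : R) (b : 'X_{1..m}) : a = b :> m.-tuple nat -> is_lead lt h b -> S h ->
    exists2 c, c.[l] != 0 & L (c *: h).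
  elim/(term_order_ind lt_term): a h b => a IH h b ab hb Sh.
  have [p pG pb] := Gcov h b Sh hb.
  have [[c1 c10 Lc1] pl] := GS p pG.
  have [p0 [c2 c20 Lc2]] := Gl p pG.
  set r := p.1@_(p.2) *: h - h@_b *: ('X_[b - p.2] * p.1).
  have [c c0 Lc] : exists2 c, c.[l] != 0 & L (c *: r).
    have [->|r0] := eqVneq r 0.
      by exists 1; rewrite ?scaler0 // hornerC oner_eq0.
    have [e re] := lead_exists lt_term r0.
    apply: (IH e _ r e) => //.
      by rewrite ab; apply: (lead_reduce lt_term hb pl pb); case: re.
    case: Sh => d d0 Ld; exists (d * c1); first by rewrite mulf_neq0.
    rewrite scalerBr; apply: idealB => //.
      have -> : (d * c1) *: (p.1@_(p.2) *: h) = (c1 * p.1@_(p.2)) *: (d *: h).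
        by rewrite !scalerA; congr (_ *: _); ring.
      exact: idealZ.
    have -> : (d * c1) *: (h@_b *: ('X_[b - p.2] * p.1)) =
        (d * h@_b) *: ('X_[b - p.2] * (c1 *: p.1)).
      by rewrite -scalerAr !scalerA; congr (_ *: _); ring.
    by apply: idealZ => //; apply: LM.
  (* Denominators of the remainder r and of the divisor, times the leading coefficient of the
     divisor: none vanishes at l. *)
  exists (c * c2 * p.1@_(p.2)); first by rewrite !hornerM !mulf_neq0.
  have -> : (c * c2 * p.1@_(p.2)) *: h =
      c2 *: (c *: r) + (c * h@_b) *: ('X_[b - p.2] * (c2 *: p.1)).
    rewrite -scalerAr !scalerBr !scalerA addrC.
    have -> : c2 * c * h@_b = c * h@_b * c2 by ring.
    by rewrite addrCA subrr addr0 [c2 * c]mulrC.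
  by apply: LD; apply: idealZ => //; apply: LM.
move=> h Lh; have [->|h0] := eqVneq h 0; first exact: L0.
have [b hb] := lead_exists lt_term h0.
have [c cl Lc] : exists2 c, c.[l] != 0 & L (c *: h).
  apply: (denom b) hb _ => //; exists ('X - l%:P) => //.
  by rewrite polyXsubC_eq0.
have /factor_theorem[q cq] : root (c - c.[l]%:P) l.
  by rewrite /root !hornerE subrr.
have -> : h = (c.[l]^-1)%:P *: (c *: h - q *: (('X - l%:P) *: h)).
  rewrite (scalerA q) -cq -scalerBl opprB addrC subrK scalerA -polyCM.
  by rewrite mulVf // scale1r.
by apply: idealZ => //; apply: idealB => //; apply: idealZ.
Qed.

(** It suffices that no leading coefficient of a finite cover of L vanishes at l: reduction by the
    cover then lowers f without changing the leading exponent of its specialization. *)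
Lemma lead_specialize_generic (L : R -> Prop) : is_ideal L ->
  generic (fun l => forall f b, L f -> is_lead lt (map_mpoly (horner_eval l) f) b ->
    exists2 g, L g & is_lead lt g b).
Proof.
move=> Lid; have [L0 LD LM] := Lid.
have [irr tr tot _ _] := lt_term.
have [G [GL Gcov]] := lead_cover L.
have : generic (fun l => forall p, p \in G -> (p.1@_(p.2)).[l] != 0).
  by apply: generic_all => p /GL[_ [p0 _]]; apply: generic_nonroot.
apply: generic_imp => l Gl f b Lf flb.
have f0 : f != 0.
  by case: flb => + _; apply: contraNneq => ->; rewrite raddf0 mcoeff0.
have [c fc] := lead_exists lt_term f0.
have [a ac] : exists a, a = c :> m.-tuple nat by exists c.
elim/(term_order_ind lt_term): a c f ac Lf f0 flb fc => a IH c f ac Lf f0 flb fc.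
have [fb0 fbmax] := flb; rewrite mcoeff_map_mpoly in fb0.
have fb : f@_b != 0 by apply: contraNneq fb0 => ->; rewrite raddf0.
have [bc|ltbc] := fc.2 b fb; first by exists f; rewrite ?bc.
(* Here c is above b, so it cannot survive specialization. *)
have fcl : (f@_c).[l] = 0.
  apply/eqP/negPn/negP => fcl.
  have := fbmax c; rewrite mcoeff_map_mpoly => /(_ fcl)[cb|ltcb].
    by rewrite cb irr in ltbc.
  by have := tr _ _ _ ltbc ltcb; rewrite irr.
have [p pG pc] := Gcov f c Lf fc.
have [Lp pl] := GL p pG; have p0 := Gl p pG.
set r := p.1@_(p.2) *: f - f@_c *: ('X_[c - p.2] * p.1).
(* The subtracted multiple of the divisor carries the factor [f@_c], which vanishes at l. *)
have rl e : (map_mpoly (horner_eval l) r)@_e =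
    (p.1@_(p.2)).[l] * (map_mpoly (horner_eval l) f)@_e.
  rewrite !mcoeff_map_mpoly mcoeffB !mcoeffZ /= /horner_eval.
  by rewrite hornerD hornerN !hornerM fcl mul0r subr0.
have rlb : is_lead lt (map_mpoly (horner_eval l) r) b.
  split=> [|e]; rewrite rl mulf_eq0 (negbTE p0) //=; last exact: fbmax.
  by rewrite mcoeff_map_mpoly.
have r0 : r != 0.
  by case: rlb => + _; apply: contraNneq => ->; rewrite raddf0 mcoeff0.
have [e re] := lead_exists lt_term r0.
apply: (IH e _ e r) => //.
  by rewrite ac; apply: (lead_reduce lt_term fc pl pc); case: re.
by apply: idealB => //; apply: idealZ => //; apply: LM.
Qed.

End GenericDivision.

(** * Polynomial functions and lifting *)

Section Evaluation.
Variables (k : fieldType) (m : nat).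
Local Notation R := {mpoly {poly k}[m]}.
Implicit Types (F : R) (l : k) (y : 'rV[k]_m).

Definition evalR l y F : k := (F.@[fun i => (y 0 i)%:P]).[l].

Lemma evalRD l y F G : evalR l y (F + G) = evalR l y F + evalR l y G.
Proof. by rewrite /evalR mevalD hornerD. Qed.

Lemma evalRB l y F G : evalR l y (F - G) = evalR l y F - evalR l y G.
Proof. by rewrite /evalR mevalB hornerD hornerN. Qed.

Lemma evalRM l y F G : evalR l y (F * G) = evalR l y F * evalR l y G.
Proof. by rewrite /evalR mevalM hornerM. Qed.

Lemma evalRZ l y c F : evalR l y (c *: F) = c.[l] * evalR l y F.
Proof. by rewrite /evalR mevalZ hornerM. Qed.

Lemma evalR0 l y : evalR l y 0 = 0.
Proof. by rewrite /evalR meval0 horner0. Qed.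

Lemma evalRC l y c : evalR l y c%:MP = c.[l].
Proof. by rewrite /evalR mevalC. Qed.

Lemma evalRX l y b : evalR l y 'X_[b] = \prod_(i < m) y 0 i ^+ tnth b i.
Proof.
rewrite /evalR mevalX horner_prod; apply: eq_bigr => i _.
by rewrite horner_exp hornerC -mnm_tnth.
Qed.

Lemma evalRXU l y i : evalR l y 'X_i = y 0 i.
Proof. by rewrite /evalR mevalXU hornerC. Qed.

Lemma evalR_sum l y (I : Type) (s : seq I) (P : pred I) (G : I -> R) :
  evalR l y (\sum_(i <- s | P i) G i) = \sum_(i <- s | P i) evalR l y (G i).
Proof. by rewrite (big_morph _ (evalRD l y) (evalR0 l y)). Qed.

(** Only the variables $X'$ are substituted, so the point moves within the slice $X_1=l$. *)
Lemma evalR_comp l y F (r : m.-tuple R) :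
  evalR l y (F \mPo r) = evalR l (\row_j evalR l y (tnth r j)) F.
Proof.
rewrite comp_mpolyEX [in RHS](mpolyE F) !evalR_sum.
apply: eq_bigr => b _; rewrite evalRZ evalRZ comp_mpolyX evalRX; congr (_ * _).
rewrite /evalR rmorph_prod horner_prod; apply: eq_bigr => i _.
by rewrite rmorphXn horner_exp mxE -mnm_tnth.
Qed.

Definition spec l F : Defs.mpoly k m := [seq ((F@_b).[l], val b) | b <- msupp F].

Lemma mcoef_spec l F (b : 'X_{1..m}) : mcoef (spec l F) b = (F@_b).[l].
Proof.
rewrite /mcoef big_map; have [bF|bF] := boolP (b \in msupp F).
  rewrite big_mkcond (bigD1_seq b) //= eqxx big1 ?addr0 // => c cb.
  by rewrite val_eqE (negbTE cb).
rewrite (memN_msupp_eq0 bF) horner0 big_seq_cond big1 // => c /andP[cF /eqP cb].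
by rewrite -(val_inj cb) cF in bF.
Qed.

Lemma meval_spec l y F : Defs.meval (spec l F) y = evalR l y F.
Proof.
rewrite /Defs.meval big_map [in RHS](mpolyE F) evalR_sum.
by apply: eq_bigr => b _; rewrite evalRZ evalRX.
Qed.

Definition constR (f : Defs.mpoly k m) : R := \sum_(p <- f) p.1%:P *: 'X_[Multinom p.2].

Lemma mcoeff_constR f (b : 'X_{1..m}) : (constR f)@_b = (mcoef f b)%:P.
Proof.
rewrite /constR (raddf_sum (mcoeff b)) /mcoef rmorph_sum /= [RHS]big_mkcond.
apply: eq_bigr => p _; rewrite mcoeffZ mcoeffX -val_eqE /=.
by case: eqP; rewrite ?mulr1 ?mulr0.
Qed.

Lemma evalR_constR l y f : evalR l y (constR f) = Defs.meval f y.
Proof.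
by rewrite evalR_sum; apply: eq_bigr => p _; rewrite evalRZ hornerC evalRX.
Qed.

Definition ofList (f : Defs.mpoly k m.+1) : R :=
  \sum_(p <- f) (p.1 *: 'X^(thead p.2) : {poly k}) *: 'X_[Multinom (pdel p.2)].

Lemma mcoeff_ofList f (b : 'X_{1..m}) t : ((ofList f)@_b)`_t = mcoef f (econs t b).
Proof.
rewrite /ofList (raddf_sum (mcoeff b)) coef_sum /mcoef /= [RHS]big_mkcond.
apply: eq_bigr => p _; rewrite mcoeffZ mcoeffX -[in RHS](econs_thead p.2).
have -> : (econs (thead p.2) (pdel p.2) == econs t b) =
    (thead p.2 == t) && (Multinom (pdel p.2) == b).
  by rewrite -!val_eqE.
case: (_ == b); last by rewrite mulr0 coef0 andbF.
by rewrite mulr1 andbT coefZ coefXn eq_sym; case: eqP; rewrite ?mulr1 ?mulr0.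
Qed.

Lemma pcons0 l y : pcons l y 0 0 = l.
Proof. by rewrite mxE unlift_none. Qed.

Lemma pconsS l y i : pcons l y 0 (lift ord0 i) = y 0 i.
Proof. by rewrite mxE liftK. Qed.

Lemma evalR_ofList l y f : evalR l y (ofList f) = Defs.meval f (pcons l y).
Proof.
rewrite evalR_sum; apply: eq_bigr => p _.
rewrite evalRZ evalRX hornerZ hornerXn -mulrA big_ord_recl pcons0.
congr (_ * (_ * _)); apply: eq_bigr => i _; rewrite pconsS.
by rewrite -[in RHS](econs_thead p.2) tnth_econsS.
Qed.

Lemma ofList_surj F : exists f, ofList f = F.
Proof.
elim/mpolyind: F => [|c b F _ _ [f fF]]; first by exists [::]; rewrite /ofList big_nil.
exists ([seq (c`_t, econs t b) | t <- iota 0 (size c)] ++ f).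
rewrite -fF /ofList big_cat big_map; congr (_ + _).
under eq_bigr do rewrite thead_econs pdel_econs.
rewrite -scaler_suml -[in RHS](coefK c) poly_def.
rewrite -[X in iota 0 X]subn0 -/(index_iota _ _) big_mkord; congr (_ *: 'X_[_]).
exact: val_inj.
Qed.

End Evaluation.

(** * Vanishing ideals and lifting from a slice *)

Section Vanishing.
Variables (k : fieldType).
Hypothesis k_inf : forall s : seq k, exists x : k, x \notin s.

(** Induction on n: with the other coordinates fixed at x, the polynomial in the first variable has
    every element of the infinite field k as a root. *)
Lemma meval_eq0_mcoef n (f : Defs.mpoly k n) :
  (forall x, Defs.meval f x = 0) -> forall a, mcoef f a = 0.
Proof.
elim: n f => [|n IH] f f0 a.
  rewrite -(f0 0) /mcoef /Defs.meval big_mkcond; apply: eq_bigr => p _.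
  by rewrite (tuple0 p.2) (tuple0 a) eqxx big_ord0 mulr1.
pose g := [seq (p.1, pdel p.2) | p <- f & thead p.2 == thead a].
have -> : mcoef f a = mcoef g (pdel a).
  rewrite /mcoef big_map big_filter_cond; apply: eq_bigl => p.
  rewrite -{1}(econs_thead p.2) -{1}(econs_thead a).
  by rewrite -!val_eqE.
apply: IH => x; rewrite /Defs.meval big_map big_filter.
(* The coefficient of q at [thead a] is the value of g at x. *)
pose q := \sum_(p <- f) (p.1 * \prod_(i < n) x 0 i ^+ tnth (pdel p.2) i)
            *: 'X^(thead p.2) : {poly k}.
have q0 : q = 0.
  apply/eqP/negPn/negP => /(infinite_nonroot k_inf)[t /negP[]].
  apply/eqP; rewrite -[RHS](f0 (pcons t x)) /q horner_sum; apply: eq_bigr => p _.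
  rewrite hornerZ hornerXn -mulrA big_ord_recl pcons0 [X in _ * X]mulrC.
  congr (_ * (_ * _)); apply: eq_bigr => i _; rewrite pconsS.
  by rewrite -[in RHS](econs_thead p.2) tnth_econsS.
have := congr1 (fun r : {poly k} => r`_(thead a)) q0.
rewrite coef0 coef_sum => q_sum; rewrite -[RHS]q_sum big_mkcond; apply: eq_bigr => p _.
by rewrite coefZ coefXn eq_sym; case: eqP; rewrite ?mulr1 ?mulr0.
Qed.

Variable m : nat.
Local Notation R := {mpoly {poly k}[m]}.

(** Since k is infinite, l is a root of every coefficient of F, and one divides coefficientwise. *)
Lemma evalR_eq0_dvd l (F : R) : (forall y, evalR l y F = 0) ->
  exists h, F = ('X - l%:P) *: h.
Proof.
move=> F0.
have Fl b : root F@_b l.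
  rewrite /root -mcoef_spec meval_eq0_mcoef // => y.
  by rewrite meval_spec.
exists (\sum_(b <- msupp F) (F@_b %/ ('X - l%:P)) *: 'X_[b]).
rewrite [LHS]mpolyE scaler_sumr; apply: eq_bigr => b _.
by rewrite scalerA mulrC divpK // dvdp_XsubCl.
Qed.

Definition vanishing_ideal (A : 'rV[k]_m.+1 -> Prop) (F : R) :=
  forall l y, A (pcons l y) -> evalR l y F = 0.

Lemma vanishing_ideal_is_ideal A : is_ideal (vanishing_ideal A).
Proof.
split=> [l y _|f g fA gA l y Aly|f g gA l y Aly].
- exact: evalR0.
- by rewrite evalRD fA // gA // addr0.
- by rewrite evalRM gA // mulr0.
Qed.

Lemma sum_is_ideal (L M : R -> Prop) : is_ideal L -> is_ideal M ->
  is_ideal (fun h => exists2 f, L f & M (h - f)).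
Proof.
move=> Lid Mid; have [L0 LD LM] := Lid; have [M0 MD MM] := Mid.
split=> [|h1 h2 [f1 Lf1 Mf1] [f2 Lf2 Mf2]|g h [f Lf Mf]].
- by exists 0; rewrite // subrr.
- by exists (f1 + f2); [apply: LD|rewrite opprD addrACA; apply: MD].
- by exists (g * f); [apply: LM|rewrite -mulrBr; apply: MM].
Qed.

(* The last m coordinates of a polynomial retraction of k^(m+1) onto A that
   preserves the first coordinate. *)
Definition retract (A : 'rV[k]_m.+1 -> Prop) := exists r : m.-tuple R,
  forall l y, let z := \row_j evalR l y (tnth r j) in
    A (pcons l z) /\ (A (pcons l y) -> z = y).

(** Adding only multiples of $X_1-l$ keeps the restriction of F to the slice. Induction on the list
    of components: the retraction onto the new one measures the failure of the previous lift
    there. *)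
Lemma lift_generic (lt : rel (m.-tuple nat)) (T : eqType) (s : seq T) (A : T -> 'rV[k]_m.+1 -> Prop) :
    term_order lt -> (forall P, P \in s -> retract (A P)) ->
  let U := fun x => exists2 P, P \in s & A P x in
  generic (fun l => forall F, (forall y, U (pcons l y) -> evalR l y F = 0) ->
    exists h, vanishing_ideal U (F + ('X - l%:P) *: h)).
Proof.
move=> lt_term; elim: s => [|P s IH] sA /=.
  exists 1; rewrite ?oner_eq0 // => l _ F _; exists 0 => l' y.
  by case.
have {IH} := IH (fun Q Qs => sA Q (@mem_behead _ (P :: s) _ Qs)).
set U := (fun x => exists2 P, P \in s & A P x).
have UA x : (exists2 Q, Q \in P :: s & A Q x) <-> U x \/ A P x.
  split=> [[Q]|[[Q Qs AQ]|AP]]; last by exists P; rewrite ?mem_head.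
    by rewrite inE => /predU1P[->|Qs AQ]; [right|left; exists Q].
  by exists Q; rewrite // inE Qs orbT.
have [r rP] := sA P (mem_head _ _).
have UI := vanishing_ideal_is_ideal U.
have PI := vanishing_ideal_is_ideal (A P).
move=> /generic_and/(_ (saturation_generic lt_term (sum_is_ideal UI PI))).
apply: generic_imp => l [lift sat] F F0.
have [|h1 UF1] := lift F; first by move=> y Uy; apply: F0; apply/UA; left.
set F1 := F + _ in UF1.
have F1l y : A P (pcons l y) -> evalR l y F1 = 0.
  move=> Ay; rewrite evalRD evalRZ hornerXsubC subrr mul0r addr0.
  by apply: F0; apply/UA; right.
(* The retraction r fixes every point of [A P]. *)
have F1r : vanishing_ideal (A P) (F1 - (F1 \mPo r)).
  move=> l' y Ay; rewrite evalRB evalR_comp.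
  by have [_ /(_ Ay) ->] := rP l' y; rewrite subrr.
(* On the slice over l, r takes values in [A P], where F1 agrees with F and so vanishes. *)
have [|h hE] := @evalR_eq0_dvd l (F1 \mPo r).
  by move=> y; rewrite evalR_comp F1l //; case: (rP l y).
(* $(X_1-l)h$ is F1 minus an element of $I(P)$, hence in $I(U)+I(P)$; saturation then splits h as h'
   in $I(U)$ plus a rest in $I(P)$. *)
have [|h' Uh' Ph'] := sat h.
  by exists F1 => //; rewrite -hE -opprB -scaleN1r; apply: (idealZ (-1) PI F1r).
exists (h1 - h') => l' y /UA[Uy|Py].
  by rewrite scalerBr addrA evalRB UF1 // evalRZ Uh' // mulr0 subr0.
rewrite scalerBr addrA -/F1.
have -> : F1 - ('X - l%:P) *: h' = (F1 - (F1 \mPo r)) + ('X - l%:P) *: (h - h').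
  by rewrite hE scalerBr addrA subrK.
by rewrite evalRD F1r // evalRZ Ph' // mulr0 addr0.
Qed.

End Vanishing.

(** * Planes *)

(** [Q0] projects onto the row space of V but may change the first coordinate, which c extracts.
    Adding the right multiple of u, a direction in V with first coordinate 1, restores it. *)
Lemma plane_projection (k : fieldType) m d (V : 'M[k]_(d, m.+1)) (u : 'rV_m.+1) :
    (u <= V)%MS -> u 0 0 = 1 ->
  exists Q : 'M[k]_m.+1, forall z : 'rV_m.+1,
    [/\ (z *m Q <= V)%MS, (z <= V)%MS -> z *m Q = z & (z *m Q) 0 0 = z 0 0].
Proof.
move=> uV u0; pose Q0 := pinvmx V *m V; pose c : 'cV[k]_m.+1 := delta_mx 0 0.
exists (Q0 + (c - Q0 *m c) *m u) => z.
have -> : z *m (Q0 + (c - Q0 *m c) *m u) = z *m Q0 + (z *m c - z *m Q0 *m c) *m u.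
  by rewrite mulmxDr (mulmxA z _ u) mulmxBr (mulmxA z Q0).
have zc (w : 'rV_m.+1) : (w *m c) 0 0 = w 0 0 by rewrite -colE mxE.
split.
- by rewrite addmx_sub // ?mulmx_sub // submxMl.
- have -> : z *m Q0 = z *m pinvmx V *m V by apply: mulmxA.
  by move=> zV; rewrite mulmxKpV // subrr mul0mx addr0.
- rewrite mxE [X in _ + X]mxE big_ord1 u0 mulr1 [X in _ + X]mxE zc.
  by rewrite [X in _ + (_ + X)]mxE zc addrCA subrr addr0.
Qed.

Lemma plane_retract (k : fieldType) m d (P : 'rV[k]_m.+1 * 'M[k]_(d, m.+1)) J :
  free_vars d (plane P) J -> ord0 \in J -> retract (plane P).
Proof.
case: P => v V [_ free] J0.
(* As $X_1$ is free, the plane has a point whose first coordinate is that of v plus 1; its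
   difference from v is the required direction. *)
have [x [[xP x0] _]] := free (v + delta_mx 0 0).
have [|Q QP] := plane_projection xP.
  by rewrite mxE (x0 _ J0) !mxE eqxx addrC addrA addNr add0r.
(* Coordinate j+1 of the affine map sending z to v + (z - v)Q; the $X_1$ part sits in the
   coefficient ring. *)
pose r j : {mpoly {poly k}[m]} := (v 0 (lift ord0 j))%:P%:MP
  + (('X - (v 0 0)%:P) * (Q 0 (lift ord0 j))%:P)%:MP
  + \sum_(i < m) (Q (lift ord0 i) (lift ord0 j))%:P *:
      ('X_i - (v 0 (lift ord0 i))%:P%:MP).
exists [tuple r j | j < m] => l y; set z := \row_j _.
have [zV zid z0] := QP (pcons l y - v).
have zE : pcons l z = v + (pcons l y - v) *m Q.
  apply/rowP => i; case: (unliftP ord0 i) => [j ->|->].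
    rewrite pconsS !mxE tnth_mktuple !evalRD !evalRC evalR_sum big_ord_recl.
    rewrite hornerM hornerXsubC !hornerC -addrA.
    congr (_ + (_ * _ + _)); first by rewrite !mxE unlift_none.
    apply: eq_bigr => a _; rewrite evalRZ evalRB evalRXU evalRC !hornerC mulrC.
    by rewrite [in RHS]mxE pconsS !mxE.
  by rewrite pcons0 mxE z0 !mxE unlift_none addrC subrK.
split=> [|yP]; first by rewrite /plane zE /= addrC addKr.
apply/rowP => j; rewrite -(pconsS l z) zE zid // addrC subrK.
exact: pconsS.
Qed.

(** * Product orders and leading exponents *)

Lemma restr_term_order m (lt : rel (m.+1.-tuple nat)) :
  term_order lt -> term_order (restr_order lt).
Proof.
have econs_inj (b c : m.-tuple nat) : econs 0 b = econs 0 c -> b = c.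
  by move=> /(congr1 (@pdel m)); rewrite !pdel_econs.
have econsD (b c : m.-tuple nat) :
    econs 0 (expadd b c) = expadd (econs 0 b) (econs 0 c).
  apply: eq_from_tnth => i; rewrite tnth_mktuple.
  case: (unliftP ord0 i) => [j ->|->]; last by rewrite !tnth_econs0.
  by rewrite !tnth_econsS tnth_mktuple.
have econs00 : econs 0 (exp0 m) = exp0 m.+1.
  apply: eq_from_tnth => i; rewrite tnth_mktuple.
  case: (unliftP ord0 i) => [j ->|->]; last by rewrite !tnth_econs0.
  by rewrite !tnth_econsS tnth_mktuple.
move=> [irr tr tot ltD lt0]; split; rewrite /restr_order.
- by move=> a; apply: irr.
- by move=> a b c; apply: tr.
- by move=> a b ab; apply: tot => /econs_inj.
- by move=> a b c ab; rewrite !econsD; apply: ltD.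
- by move=> a a0; rewrite econs00; apply: lt0; rewrite -econs00 => /econs_inj.
Qed.

Section LeadingExponents.
Variables (k : fieldType) (m : nat) (lt : rel (m.+1.-tuple nat)).
Hypothesis lt_prod : product_order lt.

(** A product order compares $X'$-exponents first and breaks ties by the degree in $X_1$; that
    degree is the size of the coefficient minus one. *)
Lemma is_LE_ofList (f : Defs.mpoly k m.+1) (b : 'X_{1..m}) :
  is_lead (restr_order lt) (ofList f) b ->
  is_LE lt f (econs (size (ofList f)@_b).-1 b).
Proof.
move=> [fb fmax]; split; first by rewrite -mcoeff_ofList -lead_coefE lead_coef_eq0.
move=> c; rewrite -(econs_thead c); set t := thead c; set e := pdel c.
rewrite -[e]/(val (Multinom e)) -mcoeff_ofList => fc.
have fe : (ofList f)@_(Multinom e) != 0 by apply: contraNneq fc => ->; rewrite coef0.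
rewrite lt_prod !pdel_econs !thead_econs.
have [<-|->] := fmax _ fe; last by right.
have : (t < size (ofList f)@_(Multinom e))%N.
  by rewrite ltnNge; apply: contraNN fc => /(nth_default 0) ->.
case: (size _) => // n; rewrite ltnS leq_eqVlt => /predU1P[->|tn]; first by left.
by right; rewrite eqxx tn orbT.
Qed.

Lemma is_LE_spec (f : Defs.mpoly k m.+1) a l : term_order lt -> is_LE lt f a ->
  ((ofList f)@_(Multinom (pdel a))).[l] != 0 ->
  is_LE (restr_order lt) (spec l (ofList f)) (pdel a).
Proof.
move=> [irr _ _ _ _] [fa fmax] fl.
have specE c := mcoef_spec l (ofList f) (Multinom c).
split=> [|b]; rewrite [mcoef _ _]specE // => fbl.
have fb : (ofList f)@_(Multinom b) != 0 by apply: contraNneq fbl => ->; rewrite horner0.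
(* Test the maximality of a on the top $X_1$-power in the coefficient of f at b. *)
have := fmax (econs (size (ofList f)@_(Multinom b)).-1 b).
rewrite -[b in econs _ b]/(val (Multinom b)) -mcoeff_ofList -lead_coefE lead_coef_eq0.
case/(_ fb) => [<-|]; first by left; rewrite pdel_econs.
rewrite lt_prod pdel_econs => /orP[bl|/andP[/eqP bE _]].
  by right.
by left.
Qed.

End LeadingExponents.

(* n = m.+1 with n >= 2; A = union of the planes in Ps. *)
Theorem mainTheorem9 (k : fieldType) (m d : nat)
  (k_inf : forall s : seq k, exists x : k, x \notin s)
  (hn : (2 <= m.+1)%N)
  (lt : rel (m.+1.-tuple nat))
  (lt_term : term_order lt) (lt_prod : product_order lt)
  (lt_vars : forall i j : 'I_m.+1, (i < j)%N -> lt (expe i) (expe j))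
  (Ps : seq ('rV[k]_m.+1 * 'M[k]_(d, m.+1)))
  (Ps_planes : forall P, P \in Ps -> is_dplane P)
  (Ps_distinct : forall i j : nat, (i < j < size Ps)%N ->
      exists x, ~ (plane (nth (0, 0) Ps i) x <-> plane (nth (0, 0) Ps j) x))
  (Ps_X1 : forall P, P \in Ps ->
      exists J : {set 'I_m.+1}, minimal_free_vars d (plane P) J /\ ord0 \in J)
  (delta : m.-tuple nat -> Prop)
  (delta_generic : exists F : seq k, forall l : k, l \notin F ->
      forall b, Dset (restr_order lt)
                  (fiber (fun x => exists2 P, P \in Ps & plane P x) l) b <-> delta b) :
  let A := fun x : 'rV[k]_m.+1 => exists2 P, P \in Ps & plane P x in
  (forall a : m.+1.-tuple nat, delta (pdel a) -> Dset lt A a) /\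
  (forall b : m.-tuple nat, (forall t : nat, Dset lt A (econs t b)) <-> delta b).
Proof.
move=> A; have [E delta_off] := delta_generic; have offE := generic_notin E.
have ltm_term := restr_term_order lt_term.
have delta_sub a : delta (pdel a) -> Dset lt A a.
  move=> da [f [fA fa]].
  have fa0 : (ofList f)@_(Multinom (pdel a)) != 0.
    have := mcoeff_ofList f (Multinom (pdel a)) (thead a); rewrite /= econs_thead.
    by move=> fE; case: fa => + _; rewrite -fE; apply: contraNneq => ->; rewrite coef0.
  (* At such an l, f(l, .) puts [pdel a] into the C-set of the fiber, against delta. *)
  have [l [lE fal]] := generic_exists k_inf (generic_and offE (generic_nonroot fa0)).
  have [_ /(_ da)] := delta_off l lE (pdel a); apply.
  exists (spec l (ofList f)); split; last exact: is_LE_spec.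
  by move=> y Ay; rewrite meval_spec evalR_ofList; apply: fA.
split=> // b; split=> [Db|db t]; last by apply: delta_sub; rewrite pdel_econs.
apply: NNPP => ndb.
have Aretract P : P \in Ps -> retract (plane P).
  by move=> /Ps_X1[J [[free _] J0]]; apply: plane_retract free J0.
have AI := vanishing_ideal_is_ideal A.
have lifts := lift_generic k_inf ltm_term Aretract.
have [l [lE [liftable spl]]] := generic_exists k_inf (generic_and offE
  (generic_and lifts (lead_specialize_generic ltm_term AI))).
have : ~ Dset (restr_order lt) (fiber A l) b by move=> /(delta_off l lE).
apply=> -[f [fA [fb fmax]]].
have [|h hA] := liftable (constR f).
  by move=> y Ay; rewrite evalR_constR; apply: fA.
set g := _ + _ in hA.
(* The lift g restricts to f on the slice, so its specialization is led by b. *)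
have gl (c : 'X_{1..m}) : (map_mpoly (horner_eval l) g)@_c = mcoef f c.
  rewrite mcoeff_map_mpoly mcoeffD mcoeffZ mcoeff_constR /= /horner_eval.
  by rewrite hornerD hornerM hornerXsubC subrr mul0r addr0 hornerC.
have [|q qA qb] := spl g (Multinom b) hA.
  by split=> [|c]; rewrite gl // => /fmax[cb|]; [left; apply: val_inj|right].
have [p pq] := ofList_surj q; rewrite -pq in qA qb.
(* The lift may have any degree t in $X_1$ at b; [Db] excludes all of them. *)
apply: (Db (size (ofList p)@_(Multinom b)).-1); exists p.
split; last exact: is_LE_ofList lt_prod _ _ qb.
move=> x Ax; have xE : x = pcons (x 0 0) (\row_j x 0 (lift ord0 j)).
  apply/rowP => i; case: (unliftP ord0 i) => [j ->|->].
    by rewrite pconsS mxE.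
  by rewrite pcons0.
by rewrite xE -evalR_ofList; apply: qA; rewrite -xE.
Qed.
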